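(* Let $\mathcal N_1,\mathcal N_2:\mathbb C^{d_{\text{in}}\times d_{\text{in}}}\to\mathbb C^{d_{\text{out}}\times d_{\text{out}}}$ be two quantum channels. Then $$d_\diamond(\mathcal N_1,\mathcal N_2)\ \le\ d_{\text{in}}\,d_{\text{out}}\,\|\mathcal J_{\mathcal N_1}-\mathcal J_{\mathcal N_2}\|_\infty .$$
   Context: A quantum channel is a completely positive trace-preserving linear map. The Choi state of $\mathcal N$ is $\mathcal J_{\mathcal N}=(\mathrm{id}\otimes\mathcal N)(|\Psi\rangle\langle\Psi|)\in\mathbb C^{d_{\text{in}}\times d_{\text{in}}}\otimes\mathbb C^{d_{\text{out}}\times d_{\text{out}}}$, where $|\Psi\rangle=\frac1{\sqrt{d_{\text{in}}}}\sum_{i=1}^{d_{\text{in}}}|i\rangle\otimes|i\rangle$ (normalized maximally entangled state). $\|\cdot\|_\infty$ is the operator norm and $\|\cdot\|_1$ the trace norm. The diamond distance is $d_\diamond(\mathcal N_1,\mathcal N_2)=\max_\rho\|(\mathrm{id}\otimes(\mathcal N_1-\mathcal N_2))(\rho)\|_1$, with the maximum over quantum states (positive semi-definite, trace $1$) $\rho\in\mathbb C^{d_{\text{in}}\times d_{\text{in}}}\otimes\mathbb C^{d_{\text{in}}\times d_{\text{in}}}$. *)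

(* Defs.v *)
From mathcomp Require Import all_boot all_order all_algebra.
From mathcomp Require Import mxtens complex.
From mathcomp Require Import classical_sets reals.

Set Implicit Arguments.
Unset Strict Implicit.
Unset Printing Implicit Defensive.

Import Order.TTheory GRing.Theory Num.Theory.
Local Open Scope ring_scope.
Local Open Scope complex_scope.
Local Open Scope sesquilinear_scope.
Local Open Scope classical_set_scope.

Section Norms.
Variable R : realType.

Definition vnorm n (v : 'cV[R[i]]_n) : R :=
  Num.sqrt (\sum_i complex.Re (`|v i 0| ^+ 2)).

Definition opnorm m n (A : 'M[R[i]]_(m, n)) : R :=
  sup [set vnorm (A *m x) | x in [set x : 'cV[R[i]]_n | vnorm x <= 1]].

(* Sum of the singular values of A, i.e. the trace of (A^* A)^(1/2); the matrix
   A^* A is normal, so spectral_diag lists its eigenvalues with multiplicity,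
   and these are real and nonnegative. *)
Definition trnorm m n (A : 'M[R[i]]_(m, n)) : R :=
  \sum_i Num.sqrt (complex.Re (spectral_diag (A^t* *m A) 0 i)).

End Norms.

Section Channels.
Variable R : realType.

(* 0 <= z in R[i] means that z is real and nonnegative; over the complex
   numbers the condition below therefore forces A to be Hermitian. *)
Definition psdmx n (A : 'M[R[i]]_n) : Prop :=
  forall x : 'cV[R[i]]_n, 0 <= (x^t* *m A *m x) 0 0.

Definition qstate n (rho : 'M[R[i]]_n) : Prop := psdmx rho /\ \tr rho = 1.

(* The tensor product of C^k and C^n is C^(k * n), with the basis vectors
   |i>|j> numbered by mxtens_index, as in the Kronecker product A *t B.
   tblock X i j is the n x n matrix (<i| (x) 1) X (|j> (x) 1), so that X is the
   sum over i, j of |i><j| (x) tblock X i j. *)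
Definition tblock k n (X : 'M[R[i]]_(k * n)) (i j : 'I_k) : 'M[R[i]]_n :=
  \matrix_(a, b) X (mxtens_index (i, a)) (mxtens_index (j, b)).

(* id (x) f, the identity acting on k x k matrices; see id_tens_tensmx. *)
Definition id_tens k n m (f : 'M[R[i]]_n -> 'M[R[i]]_m)
    (X : 'M[R[i]]_(k * n)) : 'M[R[i]]_(k * m) :=
  \sum_i \sum_j (delta_mx i j : 'M[R[i]]_k) *t f (tblock X i j).

Lemma tblock_sum k n (X : 'M[R[i]]_(k * n)) :
  X = \sum_i \sum_j (delta_mx i j : 'M[R[i]]_k) *t tblock X i j.
Proof.
apply/matrixP => u v.
case: (mxtens_indexP u) => i a; case: (mxtens_indexP v) => j b.
rewrite summxE (bigD1 i) //= summxE (bigD1 j) //= tensmxE !mxE !eqxx mul1r.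
rewrite !big1 ?addr0 // => [i' /negPf ni | j' /negPf nj].
  by rewrite summxE big1 // => j' _; rewrite tensmxE mxE eq_sym ni mul0r.
by rewrite tensmxE mxE [j == _]eq_sym nj andbF mul0r.
Qed.

Lemma id_tens_tensmx k n m (f : {linear 'M[R[i]]_n -> 'M[R[i]]_m})
    (A : 'M[R[i]]_k) (B : 'M[R[i]]_n) :
  id_tens f (A *t B) = A *t f B.
Proof.
rewrite [RHS]tblock_sum; apply: eq_bigr => i _; apply: eq_bigr => j _.
congr (_ *t _).
have -> : tblock (A *t B) i j = A i j *: B.
  by apply/matrixP => a b; rewrite mxE tensmxE !mxE.
by rewrite linearZ; apply/matrixP => a b; rewrite [RHS]mxE tensmxE !mxE.
Qed.

Definition completely_positive n m (f : 'M[R[i]]_n -> 'M[R[i]]_m) : Prop :=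
  forall k (X : 'M[R[i]]_(k * n)), psdmx X -> psdmx (id_tens f X).

Definition trace_preserving n m (f : 'M[R[i]]_n -> 'M[R[i]]_m) : Prop :=
  forall X : 'M[R[i]]_n, \tr (f X) = \tr X.

Definition quantum_channel n m (f : {linear 'M[R[i]]_n -> 'M[R[i]]_m}) : Prop :=
  completely_positive f /\ trace_preserving f.

Definition max_entangled d : 'cV[R[i]]_(d * d) :=
  (sqrtC d%:R)^-1 *:
    \sum_(i < d) (delta_mx i 0 : 'cV[R[i]]_d) *t (delta_mx i 0 : 'cV[R[i]]_d).

Definition choi n m (f : 'M[R[i]]_n -> 'M[R[i]]_m) : 'M[R[i]]_(n * m) :=
  id_tens f (max_entangled n *m (max_entangled n)^t*).

(* The supremum is a maximum: the set of states is compact. *)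
Definition diamond_dist n m (f g : 'M[R[i]]_n -> 'M[R[i]]_m) : R :=
  sup [set trnorm (id_tens (f \- g) rho) | rho in @qstate (n * n)].

End Channels.

(* Main.v *)
(* Write J for the difference of the two Choi matrices and e for its operator
   norm. As J is Hermitian, e 1 + J and e 1 - J are positive semidefinite. Since
   e 1 is the Choi matrix of the map W : X |-> din e tr(X) 1, Choi's theorem
   makes W + (N1 - N2) and W - (N1 - N2) completely positive. Applied to a state rho,
   they give - P <= H <= P, where P and H are the images of rho under id (x) W
   and id (x) (N1 - N2). In an orthonormal eigenbasis (v_j) of H the trace norm
   of H is \sum_j |<v_j, H v_j>| <= \sum_j <v_j, P v_j> = tr P = din dout e. *)

From HB Require Import structures.
Require Import Defs.
From mathcomp Require Import all_boot all_order all_algebra.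
From mathcomp Require Import mxtens complex.
From mathcomp Require Import boolp classical_sets reals.

Import Order.POrderTheory GRing.Theory Num.Theory.
Local Open Scope ring_scope.
Local Open Scope complex_scope.

Section DiamondDistance.
Set Implicit Arguments.
Unset Strict Implicit.
Unset Printing Implicit Defensive.
Local Open Scope sesquilinear_scope.
Local Open Scope ring_scope.

Variable R : realType.
Implicit Types m n k : nat.

(** * Sesquilinear forms and positive semidefinite matrices *)

Lemma trmxC_mul m n p (A : 'M[R[i]]_(m, n)) (B : 'M[R[i]]_(n, p)) :
  (A *m B)^t* = B^t* *m A^t*.
Proof. by rewrite trmx_mul map_mxM. Qed.

Lemma trmxC_delta n (i : 'I_n) :
  (delta_mx i 0 : 'cV[R[i]]_n)^t* = delta_mx 0 i.
Proof. by rewrite trmx_delta map_delta_mx. Qed.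

Lemma mx_form_delta n (A : 'M[R[i]]_n) (i j : 'I_n) :
  ((delta_mx i 0 : 'cV[R[i]]_n)^t* *m A *m (delta_mx j 0 : 'cV[R[i]]_n)) 0 0
  = A i j.
Proof. by rewrite trmxC_delta -rowE -colE !mxE. Qed.

(** Cross terms of a sesquilinear form at [u + c v]. Independent rows [p], [q] and scalars [b], [c]
    keep conjugation out of the computation; for a Hermitian square, [p], [q], [b] are the
    conjugates of [u], [v], [c]. *)
Lemma mx_formDZ (F : comNzRingType) n (A : 'M[F]_n) (p q : 'rV[F]_n)
    (u v : 'cV[F]_n) (b c : F) :
  (p *m A *m u) 0 0 = 0 -> (q *m A *m v) 0 0 = 0 ->
  ((p + b *: q) *m A *m (u + c *: v)) 0 0 =
  c * (p *m A *m v) 0 0 + b * (q *m A *m u) 0 0.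
Proof.
have addE (M N : 'M[F]_1) : (M + N) 0 0 = M 0 0 + N 0 0 by rewrite mxE.
have scaleE z (M : 'M[F]_1) : (z *: M) 0 0 = z * M 0 0 by rewrite mxE.
rewrite mulmxDr -scalemxAr !mulmxDl -!scalemxAl scalerDr !addE !scaleE.
by move=> -> ->; rewrite !mulr0 addr0 add0r addrC.
Qed.

(* Polarization: the coefficients 1 and i isolate each entry of A. *)
Lemma mx_form_eq0 n (A : 'M[R[i]]_n) :
  (forall x : 'cV[R[i]]_n, (x^t* *m A *m x) 0 0 = 0) -> A = 0.
Proof.
move=> A0.
have uv0 (u v : 'cV[R[i]]_n) (c : R[i]) :
    c * (u^t* *m A *m v) 0 0 + c^* * (v^t* *m A *m u) 0 0 = 0.
  have uvC : (u + c *: v)^t* = u^t* + c^* *: v^t*.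
    by apply/matrixP => k l; rewrite !mxE rmorphD rmorphM.
  by rewrite -(mx_formDZ _ _ (A0 u) (A0 v)) -uvC.
apply/matrixP => a b; rewrite mxE.
have {}uv0 (c : R[i]) : c * A a b + c^* * A b a = 0.
  by have := uv0 (delta_mx a 0) (delta_mx b 0) c; rewrite !mx_form_delta.
have /= := uv0 1; rewrite rmorph1 !mul1r => /eqP; rewrite addr_eq0 => /eqP Aab.
have /= := uv0 'i%R; rewrite conjCi mulNr Aab mulrN -opprD -mulr2n => /eqP.
rewrite oppr_eq0 mulrn_eq0 /= mulf_eq0 (negPf (neq0Ci _)) /= => /eqP ->.
by rewrite oppr0.
Qed.

Lemma mx_form_trmxC n (A : 'M[R[i]]_n) (x : 'cV[R[i]]_n) :
  (x^t* *m A^t* *m x) 0 0 = ((x^t* *m A *m x) 0 0)^*.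
Proof.
have -> : x^t* *m A^t* *m x = (x^t* *m A *m x)^t*.
  by rewrite !trmxC_mul trmxCK mulmxA.
by rewrite !mxE.
Qed.

(** The form of [A^t* - A] at [x] is the conjugate of a real number minus that number, so it
    vanishes and polarization applies. *)
Lemma psdmx_herm n (A : 'M[R[i]]_n) : psdmx A -> A^t* = A.
Proof.
move=> A_psd; apply/eqP; rewrite -subr_eq0; apply/eqP/mx_form_eq0 => x.
rewrite mulmxBr mulmxBl mxE [X in _ + X]mxE mx_form_trmxC.
by rewrite (geC0_conj (A_psd x)) subrr.
Qed.

Lemma psdmxD n (A B : 'M[R[i]]_n) : psdmx A -> psdmx B -> psdmx (A + B).
Proof. by move=> hA hB x; rewrite mulmxDr mulmxDl mxE addr_ge0. Qed.

Lemma psdmxZ n (c : R[i]) (A : 'M[R[i]]_n) :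
  0 <= c -> psdmx A -> psdmx (c *: A).
Proof. by move=> hc hA x; rewrite -scalemxAr -scalemxAl mxE mulr_ge0. Qed.

Lemma psdmx_sum n I (r : seq I) (P : pred I) (F : I -> 'M[R[i]]_n) :
  (forall i, P i -> psdmx (F i)) -> psdmx (\sum_(i <- r | P i) F i).
Proof.
move=> hF; apply: (big_ind (@psdmx R n)) hF => [x|]; last exact: psdmxD.
by rewrite mulmx0 mul0mx mxE.
Qed.

Lemma psdmx_congr m n (A : 'M[R[i]]_n) (K : 'M[R[i]]_(m, n)) :
  psdmx A -> psdmx (K *m A *m K^t*).
Proof.
by move=> hA x; have := hA (K^t* *m x); rewrite trmxC_mul trmxCK !mulmxA.
Qed.

Lemma dotmx_sum n (x : 'cV[R[i]]_n) : (x^t* *m x) 0 0 = \sum_i `|x i 0| ^+ 2.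
Proof.
by rewrite mxE; apply: eq_bigr => i _; rewrite !mxE normCK mulrC.
Qed.

Lemma psdmx_rank1 n (x : 'cV[R[i]]_n) : psdmx (x *m x^t*).
Proof.
have := @psdmx_congr _ _ 1%:M x; rewrite mulmx1; apply=> y.
rewrite mulmx1 dotmx_sum.
by apply: sumr_ge0 => i _; rewrite exprn_ge0.
Qed.

(** * Unitary diagonalization *)

Lemma mx_form_diag n (U : 'M[R[i]]_n) (d : 'rV[R[i]]_n) (x : 'cV[R[i]]_n) :
  (x^t* *m (U^t* *m diag_mx d *m U) *m x) 0 0 =
  \sum_i d 0 i * `|(U *m x) i 0| ^+ 2.
Proof.
rewrite !mulmxA -trmxC_mul -!mulmxA (mulmxA _ (diag_mx d)) mxE.
apply: eq_bigr => i _; rewrite mul_mx_diag mxE [(_ ^t*) _ _]mxE mxE normCK.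
by rewrite mulrAC mulrC; congr (_ * _); rewrite mulrC.
Qed.

Lemma normal_spectral n (A : 'M[R[i]]_n) : A *m A^t* = A^t* *m A ->
  exists2 U : 'M[R[i]]_n, U \is unitarymx &
    A = U^t* *m diag_mx (spectral_diag A) *m U.
Proof.
move=> /normalmxP/orthomx_spectralP AE.
exists (spectralmx A); first exact: spectral_unitarymx.
by rewrite -invmx_unitary ?spectral_unitarymx.
Qed.

(** The last clause makes each eigenvalue a diagonal entry of [U A U^*]; with [form_row] it is the
    value of the form of [A] at an eigenvector, from which its sign or reality is read off. *)
Lemma herm_spectral n (A : 'M[R[i]]_n) : A^t* = A ->
  exists U : 'M[R[i]]_n, exists d : 'rV[R[i]]_n,
    [/\ U \is unitarymx, A = U^t* *m diag_mx d *m U &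
        forall i, d 0 i = (U *m A *m U^t*) i i].
Proof.
move=> A_herm; have [|U U_unitary] := @normal_spectral _ A.
  by rewrite A_herm.
move: (spectral_diag A) => d AE; exists U, d; split=> // i.
rewrite AE !mulmxA (unitarymxP U_unitary) mul1mx mulmxtVK //.
by rewrite mxE eqxx.
Qed.

Lemma form_row n (A U : 'M[R[i]]_n) i :
  (U *m A *m U^t*) i i = (((row i U)^t*)^t* *m A *m (row i U)^t*) 0 0.
Proof.
rewrite trmxCK -row_mul !mxE; apply: eq_bigr => j _.
by congr (_ * _); rewrite !mxE.
Qed.

(** * Eigenvalues with multiplicity and the trace norm *)

(** The constant matrix [P] also intertwines [X - A] and [X - B]; taking determinants, the nonzero
    constant [det P] cancels. *)
Lemma char_poly_intertwine (F : fieldType) n (P A B : 'M[F]_n) :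
  P \in unitmx -> P *m A = B *m P -> char_poly A = char_poly B.
Proof.
move=> P_unit PA; pose Q : 'M[{poly F}]_n := map_mx polyC P.
have /(congr1 determinant) : Q *m char_poly_mx A = char_poly_mx B *m Q.
  by rewrite /char_poly_mx mulmxBr mulmxBl scalar_mxC -!map_mxM PA.
rewrite !det_mulmx mulrC; apply: mulIf.
by rewrite det_map_mx polyC_eq0 -unitfE -unitmxE.
Qed.

(** Both lists are the roots of one characteristic polynomial. This frees the trace norm from the
    particular diagonalization chosen by [spectral_diag]. *)
Lemma unitary_diag_perm n (U V : 'M[R[i]]_n) (d e : 'rV[R[i]]_n) :
  U \is unitarymx -> V \is unitarymx ->
  U^t* *m diag_mx d *m U = V^t* *m diag_mx e *m V ->
  perm_eq [seq d 0 i | i : 'I_n] [seq e 0 i | i : 'I_n].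
Proof.
move=> hU hV dE; apply: prod_XsubC_eq; rewrite !big_image /=.
have charE (W : 'M[R[i]]_n) (c : 'rV[R[i]]_n) : W \is unitarymx ->
    char_poly (W^t* *m diag_mx c *m W) = \prod_(i < n) ('X - (c 0 i)%:P).
  move=> hW.
  rewrite (char_poly_intertwine (unitarymx_unit hW) (B := diag_mx c)).
    rewrite (char_poly_trig (diag_mx_is_trig c)).
    by apply: eq_bigr => j _; rewrite mxE eqxx.
  by rewrite !mulmxA (unitarymxP hW) mul1mx.
exact: etrans (esym (charE _ _ hU)) (etrans (congr1 _ dE) (charE _ _ hV)).
Qed.

(** The same [U] diagonalizes [H^t* *m H], with eigenvalues [|d_i|^2], whose square roots are the
    singular values. *)
Lemma trnorm_herm n (H U : 'M[R[i]]_n) (d : 'rV[R[i]]_n) :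
  U \is unitarymx -> H = U^t* *m diag_mx d *m U ->
  (trnorm H)%:C = \sum_i `|d 0 i|.
Proof.
move=> hU HE; pose c : 'rV[R[i]]_n := \row_i (`|d 0 i| ^+ 2).
have HH : H^t* *m H = U^t* *m diag_mx c *m U.
  rewrite HE !trmxC_mul trmxCK -!mulmxA (mulmxA U) (unitarymxP hU) mul1mx.
  rewrite (mulmxA _ (diag_mx d)); congr (_ *m (_ *m _)).
  rewrite tr_diag_mx map_diag_mx mulmx_diag; congr diag_mx.
  by apply/rowP => j; rewrite !mxE normCK mulrC.
pose e := spectral_diag (H^t* *m H).
have [V hV HHs] : exists2 V : 'M[R[i]]_n, V \is unitarymx &
    H^t* *m H = V^t* *m diag_mx e *m V.
  by apply: normal_spectral; rewrite trmxC_mul trmxCK.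
have trE :
    trnorm H = \sum_(z <- [seq e 0 i | i : 'I_n]) Num.sqrt (complex.Re z).
  by rewrite big_image.
have ce : perm_eq [seq e 0 i | i : 'I_n] [seq c 0 i | i : 'I_n].
  by apply: unitary_diag_perm hV hU _; rewrite -HHs -HH.
rewrite trE (perm_big _ ce) /= big_image /= rmorph_sum /=.
apply: eq_bigr => j _; rewrite mxE.
by rewrite normc_def -rmorphXn /= sqrtr_sqr ger0_norm // sqrtr_ge0.
Qed.

Lemma trnorm_le_tr n (H P : 'M[R[i]]_n) :
  psdmx (P + H) -> psdmx (P - H) -> (trnorm H)%:C <= \tr P.
Proof.
move=> hD hB.
(* Positivity makes [P + H] and [P - H] Hermitian, and [2 H] is their difference. *)
have H_herm : H^t* = H.
  have H2 : 2%:R *: H = (P + H) - (P - H).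
    by rewrite scaler_nat mulr2n opprB [RHS]addrC addrA subrK.
  apply: (@scalerI _ _ 2%:R); first by rewrite pnatr_eq0.
  have -> : 2%:R *: H^t* = (2%:R *: H)^t*.
    by apply/matrixP => j k; rewrite !mxE rmorphM /= rmorph_nat.
  rewrite H2 -[in RHS](psdmx_herm hD) -[in RHS](psdmx_herm hB).
  by rewrite linearB map_mxB.
have [U [d [hU HE dE]]] := herm_spectral H_herm.
have -> : \tr P = \tr (U *m P *m U^t*).
  rewrite mxtrace_mulC mulmxA -invmx_unitary // mulVmx ?mul1mx //.
  exact: unitarymx_unit.
rewrite (trnorm_herm hU HE); apply: ler_sum => j _.
have diag_ge0 (K : 'M[R[i]]_n) : psdmx K -> 0 <= (U *m K *m U^t*) j j.
  by move=> hK; rewrite form_row.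
have := diag_ge0 _ hB; have := diag_ge0 _ hD.
rewrite mulmxBr mulmxBl mulmxDr mulmxDl mxE [X in _ -> 0 <= X -> _]mxE.
rewrite [X in _ -> 0 <= _ + X -> _]mxE -dE.
move: (d 0 j) (_ j j) => r p pDr_ge0 pBr_ge0.
(* The order on [R[i]] is partial, so instead of splitting on the sign of [r], both sides are
   doubled and the triangle inequality is applied to [(p + r) - (p - r)]. *)
rewrite -(ler_pMn2r (ltn0Sn 1)) -normrMn.
have -> : r *+ 2 = (p + r) - (p - r) by rewrite opprB addrC addrA subrK mulr2n.
have -> : p *+ 2 = `|p + r| + `|p - r|.
  by rewrite !ger0_norm // addrACA subrr addr0 mulr2n.
exact: ler_normB.
Qed.

(** * Positivity and spectral decompositions *)

Lemma psdmx_unitary_diag n (U : 'M[R[i]]_n) (d : 'rV[R[i]]_n) :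
  (forall j, 0 <= d 0 j) -> psdmx (U^t* *m diag_mx d *m U).
Proof.
move=> d_ge0 x; rewrite mx_form_diag; apply: sumr_ge0 => j _.
by rewrite mulr_ge0 ?exprn_ge0.
Qed.

Lemma psdmx_rank1_decomp n (A : 'M[R[i]]_n) : psdmx A ->
  exists x : 'I_n -> 'cV[R[i]]_n, A = \sum_j x j *m (x j)^t*.
Proof.
move=> A_psd; have [U [d [_ AE dE]]] := herm_spectral (psdmx_herm A_psd).
have d_ge0 j : 0 <= d 0 j by rewrite dE form_row.
(* The j-th column of [U^*] is an eigenvector for [d 0 j]; the square root of the eigenvalue is
   absorbed into it. *)
exists (fun j => sqrtC (d 0 j) *: (row j U)^t*).
apply/matrixP => a b; rewrite summxE {1}AE -mulmxA mul_diag_mx mxE.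
apply: eq_bigr => j _; rewrite !mxE big_ord1 !mxE.
have sqrt_ge0 : 0 <= sqrtC (d 0 j) by rewrite sqrtC_ge0.
rewrite rmorphM /= conjCK (geC0_conj sqrt_ge0).
by rewrite mulrACA -expr2 sqrtCK mulrCA.
Qed.

(** * The operator norm *)

Lemma vnorm_sqr n (v : 'cV[R[i]]_n) :
  (vnorm v ^+ 2)%:C = \sum_j `|v j 0| ^+ 2.
Proof.
have normE j : (complex.Re (`|v j 0| ^+ 2))%:C = `|v j 0| ^+ 2.
  by rewrite RRe_real // ger0_real ?exprn_ge0.
rewrite sqr_sqrtr.
  by rewrite (rmorph_sum (real_complex R)); apply: eq_bigr => j _; exact: normE.
by apply: sumr_ge0 => j _; rewrite -ler0c normE exprn_ge0.
Qed.

Lemma vnorm_unitary n (U : 'M[R[i]]_n) (x : 'cV[R[i]]_n) :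
  U \is unitarymx -> vnorm (U *m x) = vnorm x.
Proof.
move=> hU; apply/eqP; rewrite -(@eqrXn2 _ 2) ?sqrtr_ge0 //.
rewrite -(inj_eq (@complexI R)) !vnorm_sqr -!dotmx_sum trmxC_mul -mulmxA.
by rewrite (mulmxA _ U) -invmx_unitary // mulVmx ?mul1mx // unitarymx_unit.
Qed.

(** The unit eigenvector [U^* e_j] is mapped to a vector of norm [|d_j|], which therefore belongs to
    the set whose supremum is [opnorm]. *)
Lemma normr_eigenvalue_le_opnorm n (U : 'M[R[i]]_n) (d : 'rV[R[i]]_n) j :
  U \is unitarymx -> `|d 0 j| <= (opnorm (U^t* *m diag_mx d *m U))%:C.
Proof.
move=> hU; have hU' : U^t* \is unitarymx by rewrite trmxC_unitary.
set A := _ *m U.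
have vnormA (x : 'cV[R[i]]_n) : vnorm (A *m x) = vnorm (diag_mx d *m (U *m x)).
  by rewrite /A -!mulmxA vnorm_unitary.
have diagE (y : 'cV[R[i]]_n) :
    (vnorm (diag_mx d *m y) ^+ 2)%:C = \sum_k `|d 0 k| ^+ 2 * `|y k 0| ^+ 2.
  rewrite vnorm_sqr; apply: eq_bigr => k _.
  by rewrite mul_diag_mx mxE normrM exprMn.
pose e : 'cV[R[i]]_n := delta_mx j 0.
have deltaE (F : 'I_n -> R[i]) : \sum_k F k * `|e k 0| ^+ 2 = F j.
  rewrite (bigD1 j) //= big1 ?addr0 => [|k /negPf kj]; rewrite mxE.
    by rewrite !eqxx normr1 expr1n mulr1.
  by rewrite kj normr0 expr0n mulr0.
have e1 : vnorm e = 1.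
  apply/eqP; rewrite -(@eqrXn2 _ 2) ?sqrtr_ge0 //.
  rewrite -(inj_eq (@complexI R)) vnorm_sqr expr1n.
  have := deltaE (fun=> 1); under eq_bigr do rewrite mul1r.
  by move=> ->.
have Ae : (vnorm (A *m (U^t* *m e)))%:C = `|d 0 j|.
  rewrite vnormA (mulmxA U) (unitarymxP hU) mul1mx.
  apply/eqP; rewrite -(@eqrXn2 _ 2) ?normr_ge0 ?ler0c ?sqrtr_ge0 //.
  by rewrite -rmorphXn /= diagE deltaE.
have Ue_le1 : vnorm (U^t* *m e) <= 1 by rewrite vnorm_unitary // e1.
rewrite -Ae lecR /opnorm; move: (_ *m e) Ue_le1 => f f_le1.
apply: ub_le_sup; last by exists f.
(* The supremum bounds its members only if the set is bounded. The Frobenius norm is an upper bound,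
   since every coordinate of [U x] has modulus at most 1. *)
exists (Num.sqrt (complex.Re (\sum_k `|d 0 k| ^+ 2))) => _ [x /= x1 <-].
rewrite -[vnorm _]ger0_norm ?sqrtr_ge0 // -sqrtr_sqr ler_wsqrtr //.
rewrite -lecR vnormA diagE RRe_real; last first.
  by rewrite ger0_real ?sumr_ge0 // => k _; rewrite exprn_ge0.
apply: ler_sum => k _; rewrite ler_piMr ?exprn_ge0 //.
have : (vnorm (U *m x) ^+ 2)%:C <= 1.
  by rewrite vnorm_unitary // -[1]/(1%:C) lecR expr_le1 ?sqrtr_ge0.
apply: le_trans; rewrite vnorm_sqr (bigD1 k) //= lerDl.
by apply: sumr_ge0 => l _; rewrite exprn_ge0.
Qed.

Lemma psdmx_opnorm n (A : 'M[R[i]]_n) : A^t* = A ->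
  psdmx ((opnorm A)%:C%:M + A) /\ psdmx ((opnorm A)%:C%:M - A).
Proof.
move=> A_herm; have [U [d [hU AE dE]]] := herm_spectral A_herm.
set c := _%:C.
have d_le j : `|d 0 j| <= c by rewrite /c AE normr_eigenvalue_le_opnorm.
have d_real j : d 0 j \is Num.real.
  by apply/CrealP; rewrite dE form_row -mx_form_trmxC A_herm.
(* A scalar matrix is diagonal in the eigenbasis of [A] too, so [c 1 + A] and [c 1 - A] have
   eigenvalues [c + d_j] and [c - d_j]. *)
have cE : c%:M = U^t* *m diag_mx (const_mx c) *m U.
  rewrite diag_const_mx mul_mx_scalar -scalemxAl -invmx_unitary //.
  by rewrite mulVmx ?unitarymx_unit // scalemx1.
have cd_ge0 j : 0 <= c + d 0 j /\ 0 <= c - d 0 j.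
  have := d_le j; rewrite real_ler_norml // => /andP[dl du].
  by rewrite subr_ge0 -lerBlDl sub0r.
split.
  have -> : c%:M + A = U^t* *m diag_mx (const_mx c + d) *m U.
    by rewrite cE AE linearD /= mulmxDr mulmxDl.
  by apply: psdmx_unitary_diag => j; rewrite !mxE; case: (cd_ge0 j).
have -> : c%:M - A = U^t* *m diag_mx (const_mx c - d) *m U.
  by rewrite cE AE linearB /= mulmxBr mulmxBl.
by apply: psdmx_unitary_diag => j; rewrite !mxE; case: (cd_ge0 j).
Qed.

(** * The extension [id_tens], Choi matrices and Choi's theorem *)

Lemma mul_delta_mx_rank1 m n p q (A : 'M[R[i]]_(m, n)) (B : 'M[R[i]]_(p, q))
    (i : 'I_n) (j : 'I_p) :
  A *m delta_mx i j *m B = col i A *m row j B.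
Proof. by rewrite -(mul_delta_mx (0 : 'I_1)) mulmxA -colE -mulmxA -rowE. Qed.

Lemma id_tensE k n m (f : 'M[R[i]]_n -> 'M[R[i]]_m) (X : 'M[R[i]]_(k * n))
    (a b : 'I_k) (p q : 'I_m) :
  id_tens f X (mxtens_index (a, p)) (mxtens_index (b, q)) =
  f (tblock X a b) p q.
Proof.
rewrite summxE (bigD1 a) //= summxE (bigD1 b) //= tensmxE mxE !eqxx mul1r.
rewrite !big1 ?addr0 // => [c /negPf ca | c /negPf cb].
  by rewrite summxE big1 // => d _; rewrite tensmxE mxE eq_sym ca mul0r.
by rewrite tensmxE mxE [b == _]eq_sym cb andbF mul0r.
Qed.

Lemma id_tens_linear_sum k n m (f : {linear 'M[R[i]]_n -> 'M[R[i]]_m})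
    (I : finType) (X : I -> 'M[R[i]]_(k * n)) :
  id_tens f (\sum_j X j) = \sum_j id_tens f (X j).
Proof.
apply/matrixP => u v.
case: (mxtens_indexP u) => a p; case: (mxtens_indexP v) => b q.
rewrite id_tensE summxE.
have -> : tblock (\sum_j X j) a b = \sum_j tblock (X j) a b.
  apply/matrixP => c d; rewrite summxE mxE summxE.
  by apply: eq_bigr => j _; rewrite mxE.
by rewrite linear_sum summxE; apply: eq_bigr => j _; rewrite id_tensE.
Qed.

Lemma id_tensD k n m (f g : 'M[R[i]]_n -> 'M[R[i]]_m) (X : 'M[R[i]]_(k * n)) :
  id_tens (f \+ g) X = id_tens f X + id_tens g X.
Proof.
apply/matrixP => u v.
case: (mxtens_indexP u) => a p; case: (mxtens_indexP v) => b q.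
by rewrite [RHS]mxE !id_tensE mxE.
Qed.

Lemma id_tensB k n m (f g : 'M[R[i]]_n -> 'M[R[i]]_m) (X : 'M[R[i]]_(k * n)) :
  id_tens (f \- g) X = id_tens f X - id_tens g X.
Proof.
apply/matrixP => u v.
case: (mxtens_indexP u) => a p; case: (mxtens_indexP v) => b q.
by rewrite [RHS]mxE [X in _ + X]mxE !id_tensE mxE [X in _ + X]mxE.
Qed.

Lemma mxtrace_id_tens k n m (f : 'M[R[i]]_n -> 'M[R[i]]_m)
    (X : 'M[R[i]]_(k * n)) :
  \tr (id_tens f X) = \sum_a \tr (f (tblock X a a)).
Proof.
have index_bij : {on predT, bijective (@mxtens_index k m)}.
  apply: onW_bij; exists (@mxtens_unindex k m).
    exact: mxtens_indexK.
  exact: mxtens_unindexK.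
rewrite /mxtrace.
under [RHS]eq_bigr => a _ do under eq_bigr => p _ do rewrite -id_tensE.
rewrite pair_bigA /= (reindex _ index_bij) /=.
by apply: eq_bigr => -[].
Qed.

Lemma tblock_max_entangled n (a b : 'I_n) :
  tblock (max_entangled R n *m (max_entangled R n)^t*) a b =
  n%:R^-1 *: delta_mx a b.
Proof.
have entE (c d : 'I_n) : max_entangled R n (mxtens_index (c, d)) 0 =
    (sqrtC n%:R)^-1 * (c == d)%:R.
  rewrite mxE summxE (bigD1 c) //= big1 ?addr0 => [|e /negPf ec].
    by rewrite !mxE mxtens_indexK /= !eqxx /= !ord1 !eqxx !andbT mul1r eq_sym.
  by rewrite !mxE mxtens_indexK /= eq_sym ec /= mul0r.
move: (max_entangled R n) entE => w entE.
apply/matrixP => c d; rewrite !mxE big_ord1 !mxE !entE.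
rewrite rmorphM /= rmorph_nat fmorphV /=.
have sqrt_ge0 : 0 <= sqrtC (n%:R : R[i]) by rewrite sqrtC_ge0 ler0n.
rewrite (geC0_conj sqrt_ge0) mulrACA -invfM -expr2 sqrtCK -natrM mulnb.
by rewrite ![c == _]eq_sym ![d == _]eq_sym.
Qed.

Lemma choiE n m (f : {linear 'M[R[i]]_n -> 'M[R[i]]_m}) :
  choi f = n%:R^-1 *: \sum_a \sum_b delta_mx a b *t f (delta_mx a b).
Proof.
rewrite /choi /id_tens scaler_sumr; apply: eq_bigr => a _; rewrite scaler_sumr.
apply: eq_bigr => b _; rewrite tblock_max_entangled linearZ.
by apply/matrixP => u v; rewrite !mxE mulrCA.
Qed.

(** With [V] the matrix of coordinates of [x], one has [x = (V (x) 1) \sum_i |i>|i>]. The factor [V]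
    acts on the side left alone by [f], so it comes out of [id_tens f] as [K = V (x) 1]; the factor
    [n] undoes the normalization of the entangled vector. *)
Lemma id_tens_rank1 k n m (f : {linear 'M[R[i]]_n -> 'M[R[i]]_m})
    (x : 'cV[R[i]]_(k * n)) :
  exists K : 'M[R[i]]_(k * m, n * m),
    id_tens f (x *m x^t*) = n%:R *: (K *m choi f *m K^t*).
Proof.
pose V : 'M[R[i]]_(k, n) := \matrix_(a, i) x (mxtens_index (a, i)) 0.
(* For [n = 0] the scalar [n] cannot be cancelled against its inverse, but every block of [x x^*] is
   empty and both sides vanish. *)
have [n0|n_gt0] := posnP n.
  exists 0; rewrite mul0mx mul0mx scaler0.
  apply/matrixP => u v.
  case: (mxtens_indexP u) => a p; case: (mxtens_indexP v) => b q.
  rewrite id_tensE mxE; have -> : tblock (x *m x^t*) a b = 0.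
    by apply/matrixP => c; have := ltn_ord c; rewrite {2}n0.
  by rewrite linear0 mxE.
exists (V *t 1%:M).
have -> : (V *t (1%:M : 'M[R[i]]_m))^t* = V^t* *t 1%:M.
  by rewrite trmx_tens map_mxT trmx1 map_mx1.
rewrite choiE -scalemxAr -scalemxAl scalerA mulfV ?pnatr_eq0 -?lt0n // scale1r.
rewrite mulmx_sumr mulmx_suml.
apply/matrixP => u v.
case: (mxtens_indexP u) => a p; case: (mxtens_indexP v) => b q.
rewrite id_tensE (matrix_sum_delta (tblock _ a b)) linear_sum !summxE.
apply: eq_bigr => c _; rewrite linear_sum mulmx_sumr mulmx_suml !summxE.
apply: eq_bigr => d _; rewrite linearZ !tensmx_mul mul1mx mulmx1 tensmxE.
rewrite mul_delta_mx_rank1 mxE; congr (_ * _).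
by rewrite !mxE !big_ord1 !mxE.
Qed.

(** A positive [X] is a sum of rank-one terms, and the image of each is a nonnegative multiple of a
    congruence of the Choi matrix. *)
Lemma psdmx_choi_completely_positive n m
    (f : {linear 'M[R[i]]_n -> 'M[R[i]]_m}) :
  psdmx (choi f) -> completely_positive f.
Proof.
move=> choi_psd k X /psdmx_rank1_decomp[x ->].
rewrite id_tens_linear_sum; apply: psdmx_sum => j _.
have [K ->] := id_tens_rank1 f (x j).
by apply: psdmxZ; [rewrite ler0n | exact: psdmx_congr].
Qed.

(** * The comparison map and the final estimate *)

(** A multiple of the completely depolarizing map, used because its Choi matrix is scalar. *)
Definition trace_scalar n m (c : R[i]) (X : 'M[R[i]]_n) : 'M[R[i]]_m :=
  (c * \tr X)%:M.

Lemma trace_scalar_is_linear n m c : linear (@trace_scalar n m c).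
Proof.
move=> a X Y; apply/matrixP => p q.
by rewrite !mxE linearP mulrDr mulrCA mulrnDl mulrnAr.
Qed.

HB.instance Definition _ n m c :=
  GRing.isLinear.Build R[i] 'M[R[i]]_n 'M[R[i]]_m _ (@trace_scalar n m c)
    (@trace_scalar_is_linear n m c).

Lemma choi_trace_scalar n m c :
  choi (@trace_scalar n m c) = (n%:R^-1 * c)%:M.
Proof.
apply/matrixP => u v.
case: (mxtens_indexP u) => a p; case: (mxtens_indexP v) => b q.
rewrite id_tensE tblock_max_entangled mxE [RHS]mxE linearZ /=.
rewrite (inj_eq (can_inj (@mxtens_indexK n m))) xpair_eqE.
have -> : \tr (delta_mx a b : 'M[R[i]]_n) = (a == b)%:R.
  rewrite /mxtrace (bigD1 a) //= big1 ?addr0 => [|d /negPf da]; rewrite mxE.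
    by rewrite eqxx.
  by rewrite da.
by case: (a == b); rewrite ?mulr0 ?mul0rn ?mulr1 ?[c * _]mulrC.
Qed.

Lemma mxtrace_id_tens_trace_scalar k n m c (X : 'M[R[i]]_(k * n)) :
  \tr (id_tens (@trace_scalar n m c) X) = m%:R * c * \tr X.
Proof.
(* By [tblock_sum], [X] is its own image under [id_tens id], so the trace formula applies to the
   identity map. *)
have -> : \tr X = \sum_a \tr (tblock X a a).
  by rewrite {1}(tblock_sum X) -(mxtrace_id_tens id X).
rewrite mxtrace_id_tens mulr_sumr; apply: eq_bigr => a _.
by rewrite mxtrace_scalar -mulrA mulr_natl.
Qed.

(** The Choi matrix is the image of a rank-one projector under [id_tens f], hence positive
    semidefinite. *)
Lemma choi_herm n m (f : {linear 'M[R[i]]_n -> 'M[R[i]]_m}) :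
  completely_positive f -> (choi f)^t* = choi f.
Proof. by move=> f_cp; apply/psdmx_herm/f_cp/psdmx_rank1. Qed.

Lemma opnorm_ge0 m n (A : 'M[R[i]]_(m, n)) : 0 <= opnorm A.
Proof.
rewrite /opnorm; set E := image _ _.
(* Without a supremum in the proper sense, [sup] takes the default value 0. *)
have [[E_neq0 E_ub]|/sup_out->//] := pselect (has_sup E).
case: E_neq0 => y [x x_le1 yE]; rewrite /E in E_ub *.
apply: (@le_trans _ _ (vnorm (A *m x))).
  exact: sqrtr_ge0.
by apply: (ub_le_sup E_ub); exists x.
Qed.

Lemma trnorm_id_tens_le k n m (f : {linear 'M[R[i]]_n -> 'M[R[i]]_m})
    (rho : 'M[R[i]]_(k * n)) :
  (0 < n)%N -> (choi f)^t* = choi f -> qstate rho ->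
  trnorm (id_tens f rho) <= n%:R * m%:R * opnorm (choi f).
Proof.
move=> n_gt0 choi_f [rho_psd rho1]; have [hD hB] := psdmx_opnorm choi_f.
(* The factor [n] compensates the [1/n] in the normalized Choi matrix, so that [choi g] is exactly
   the operator norm times the identity. *)
pose c : R[i] := n%:R * (opnorm (choi f))%:C.
pose g : {linear 'M[R[i]]_n -> 'M[R[i]]_m} := @trace_scalar n m c.
have choi_g : choi g = (opnorm (choi f))%:C%:M.
  by rewrite choi_trace_scalar mulKf // pnatr_eq0 -lt0n.
have gD : completely_positive (g \+ f).
  apply: psdmx_choi_completely_positive.
  have -> : choi (g \+ f) = choi g + choi f by apply: id_tensD.
  by rewrite choi_g.
have gB : completely_positive (g \- f).
  apply: psdmx_choi_completely_positive.
  have -> : choi (g \- f) = choi g - choi f by apply: id_tensB.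
  by rewrite choi_g.
have domD : psdmx (id_tens g rho + id_tens f rho).
  by rewrite -id_tensD; exact: gD.
have domB : psdmx (id_tens g rho - id_tens f rho).
  by rewrite -id_tensB; exact: gB.
have := trnorm_le_tr domD domB.
rewrite mxtrace_id_tens_trace_scalar rho1 mulr1 /c mulrA [m%:R * _]mulrC.
by rewrite -!(rmorph_nat (real_complex R)) -!rmorphM lecR.
Qed.

End DiamondDistance.

Theorem lemma3p2 (R : realType) (din dout : nat)
    (N1 N2 : {linear 'M[R[i]]_din -> 'M[R[i]]_dout})
    (hN1 : quantum_channel N1) (hN2 : quantum_channel N2) :
  diamond_dist N1 N2 <=
    din%:R * dout%:R * opnorm (choi N1 - choi N2).
Proof.
have choiB : choi (N1 \- N2) = choi N1 - choi N2 by apply: id_tensB.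
have choi_sub_herm : ((choi (N1 \- N2))^t* = choi (N1 \- N2))%sesqui.
  rewrite choiB linearB map_mxB.
  by rewrite (choi_herm hN1.1) (choi_herm hN2.1).
have state_le rho : qstate rho ->
    trnorm (id_tens (N1 \- N2) rho) <=
    din%:R * dout%:R * opnorm (choi N1 - choi N2).
  move=> rho_state; rewrite -choiB; apply: trnorm_id_tens_le => //.
  (* In input dimension 0 there is no state: an empty matrix has trace 0, not 1. *)
  case: posnP rho rho_state => // -> rho [_ rho1].
  have : (1 : R[i]) = 0.
    rewrite -rho1 /mxtrace; apply: big1 => -[j lt_j] _.
    by suff : false by []; move: lt_j; rewrite muln0.
  by move/eqP; rewrite oner_eq0.
rewrite /diamond_dist; set S := (X in sup X).
(* [ge_sup] requires a nonempty set; on the empty set [sup] is 0 and the bound is nonnegative. *)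
have [->|/eqP/set0P S_neq0] := pselect (S = set0).
  by rewrite sup0 !mulr_ge0 ?ler0n ?opnorm_ge0.
by apply: ge_sup => // _ [rho rho_state <-]; exact: state_le.
Qed.
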